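(* Let $k\ge 1$ be an integer and let $G$ be a graph of $k$-parallel paths without isolated vertices. Then $F_t(G)\le 2k$. This bound is sharp: for every $k\ge 1$ there is a graph $G$ of $k$-parallel paths without isolated vertices such that $F_t(G)=2k$.
   Context: Graphs are finite, simple and undirected. Forcing process: starting from a set $F\subseteq V(G)$ of colored vertices (all others non-colored), at each step every colored vertex with exactly one non-colored neighbor forces that neighbor to become colored; this is iterated until nothing changes. $F$ is a forcing set of $G$ if all vertices eventually become colored. A total forcing set is a forcing set $F$ such that the induced subgraph $G[F]$ has no isolated vertex. The total forcing number $F_t(G)$ is the minimum cardinality of a total forcing set of $G$. Graphs of $k$-parallel paths: a graph of $1$-parallel paths is a path. For $k\ge 2$, a graph $G$ is a graph of $k$-parallel paths if it is not a graph of $j$-parallel paths for any $1\le j<k$, and there exist $k$ vertex-disjoint induced paths of $G$ covering all vertices of $G$ such that $G$ can be drawn in the plane so that these $k$ paths lie along $k$ distinct parallel horizontal lines (each path drawn horizontally, consecutive vertices joined by horizontal segments; a one-vertex path is a single point), every edge with ends in different paths is drawn as a straight line segment (not passing through vertices other than its ends), and no two such segments cross each other. Segments are allowed to cross the horizontal paths. *)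

(* Defs.v *)
From mathcomp Require Import all_boot all_order all_algebra.
From mathcomp Require Import reals.

Set Implicit Arguments.
Unset Strict Implicit.
Unset Printing Implicit Defensive.

Import Order.TTheory GRing.Theory Num.Theory.

Record sgraph := SGraph {
  vertex :> finType;
  edge : rel vertex;
  edge_sym : symmetric edge;
  edge_irrefl : irreflexive edge }.

Definition nbrs (G : sgraph) (u : G) : {set G} := [set v | edge u v].

Definition no_isolated_vertex (G : sgraph) : Prop :=
  forall u : G, exists v : G, edge u v.

Section Forcing.
Variable G : sgraph.
Implicit Types A : {set G}.

Definition force_step A : {set G} :=
  A :|: [set v | [exists u in A, nbrs u :\: A == [set v]]].

(* The process is stationary after at most #|G| steps; see [forcingP]. *)
Definition forcing A : bool := iter #|G| force_step A == [set: G].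

Lemma forcingP A :
  reflect (exists n, iter n force_step A = [set: G]) (forcing A).
Proof.
apply: (iffP eqP) => [|[n defT]]; first by exists #|G|.
have stable m : force_step (iter m force_step A) = iter m force_step A ->
    forall l, iter (l + m) force_step A = iter m force_step A.
  by move=> fixm; elim=> // l IHl; rewrite addSn iterS IHl.
have grow m : force_step (iter m force_step A) = iter m force_step A
    \/ m <= #|iter m force_step A|.
  elim: m => [|m [fixm|lem]]; [by right | by left; rewrite iterS !fixm |].
  case: (eqVneq (force_step (iter m force_step A)) (iter m force_step A)).
    by move=> fixm; left; rewrite iterS !fixm.
  move=> nfix; right; rewrite iterS; apply: (leq_ltn_trans lem).
  by apply: proper_card; rewrite properEneq eq_sym nfix subsetUl.
have full : force_step [set: G] = [set: G] by rewrite /force_step setTU.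
case: (leqP n #|G|) => [len|/ltnW leG].
  by rewrite -(subnK len) stable defT.
case: (grow #|G|) => [fixG|geG].
  by rewrite -defT -(subnK leG) stable.
by apply/eqP; rewrite eqEcard subsetT cardsT.
Qed.

Definition total_forcing A : bool :=
  forcing A && [forall u in A, [exists v in A, edge u v]].

(* If G has no isolated vertex then [set: G] is a total forcing set, so this is
   the minimum cardinality; otherwise there is no total forcing set and the
   value #|G| is meaningless. *)
Definition total_forcing_number : nat :=
  #|[arg min_(A < [set: G] | total_forcing A) #|A|]|.

End Forcing.

Section ParallelPaths.
Variables (R : realType) (G : sgraph).
Local Open Scope ring_scope.

(* The vertices of s, in this order, induce a (nonempty) path of G. *)
Definition induced_path (s : seq G) : Prop :=
  [/\ s <> [::], uniq s
    & {in s &, forall u v, edge u v =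
        (index v s == (index u s).+1) || (index u s == (index v s).+1)}].

Definition is_path_graph : Prop :=
  exists2 s : seq G, induced_path s & forall v : G, v \in s.

Definition in_open_segment (a b p : R * R) : Prop :=
  exists2 t : R, 0 < t < 1
    & p = ((1 - t) * a.1 + t * b.1, (1 - t) * a.2 + t * b.2).

Definition cross_edge k (P : 'I_k -> seq G) (u v : G) : Prop :=
  edge u v /\ forall i, ~ (u \in P i /\ v \in P i).

(* [pos] gives the vertices coordinates in the plane, the path [P i] lying at
   height [h i]. As [P i] may be listed from either of its ends, it is no
   restriction to ask that abscissas increase along it. Since segments avoid
   the vertices other than their ends, two segments coming from distinct edges
   cross exactly when they have a common point interior to both. *)
Definition parallel_drawing k (P : 'I_k -> seq G) (h : 'I_k -> R)
    (pos : G -> R * R) : Prop :=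
  [/\ injective h,
      forall i, {in P i, forall v, (pos v).2 = h i},
      forall i, sorted (fun u v => (pos u).1 < (pos v).1) (P i),
      forall u v w, cross_edge P u v ->
        ~ in_open_segment (pos u) (pos v) (pos w)
    & forall u v u' v', cross_edge P u v -> cross_edge P u' v' ->
        [set u; v] <> [set u'; v'] ->
        forall p, ~ (in_open_segment (pos u) (pos v) p
                  /\ in_open_segment (pos u') (pos v') p)].

Definition has_parallel_drawing k : Prop :=
  exists P : 'I_k -> seq G,
    [/\ forall i, induced_path (P i),
        forall v, exists! i, v \in P i
      & exists h pos, parallel_drawing P h pos].

(* [parallel_paths] is defined by recursion on k; [parallel_paths1] and
   [parallel_pathsSS] below give its defining equations. In [parallel_at], the
   argument [nofewer] stands for "G is not a graph of j-parallel paths for any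
   1 <= j < k". *)
Definition parallel_at (nofewer : Prop) (k : nat) : Prop :=
  match k with
  | 0 => False
  | 1 => is_path_graph
  | _ => nofewer /\ has_parallel_drawing k
  end.

Fixpoint no_fewer (k : nat) : Prop :=
  if k is j.+1 then no_fewer j /\ ~ parallel_at (no_fewer j) j else True.

Definition parallel_paths (k : nat) : Prop := parallel_at (no_fewer k) k.

Lemma parallel_paths1 : parallel_paths 1 = is_path_graph.
Proof. by []. Qed.

Lemma parallel_pathsSS k :
  parallel_paths k.+2 <->
  (forall j, (1 <= j < k.+2)%N -> ~ parallel_paths j)
    /\ has_parallel_drawing k.+2.
Proof.
suff nofewerE n : no_fewer n <-> forall j, (1 <= j < n)%N -> ~ parallel_paths j.
  by rewrite {1}/parallel_paths /parallel_at nofewerE.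
elim: n => [|n [IH1 IH2]]; first by split=> // _ j; rewrite andbF.
split=> [[/IH1 lt_n nn] j /andP[j0]|H].
  by rewrite ltnS leq_eqVlt => /orP[/eqP-> //|jn]; apply: lt_n; rewrite j0.
split; first by apply: IH2 => j /andP[j0 jn]; apply: H; rewrite j0 ltnW.
by case: n {IH1 IH2} H => [|n] H; [case | apply: H; rewrite /= ltnSn].
Qed.

End ParallelPaths.

(* Main.v *)
Require Import Defs.
From mathcomp Require Import all_boot all_order all_algebra.
From mathcomp Require Import reals.
From mathcomp Require Import ring lra.

(**
The left ends of the [k] paths form a forcing set. Suppose that the process
started from a set containing them is stationary but incomplete, and let [f i]
be the last vertex of the coloured prefix of a path [P i] that is not entirely
coloured. Besides its successor on [P i], the vertex [f i] has a non-coloured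
neighbour, and as [P i] is induced this neighbour lies to the right of [f j] on
another incomplete path [P j]. So each incomplete line [i] carries a point at
or left of [f i] from which a segment runs to a point right of some [f j]. This
property survives deleting the top line: a segment arriving at the top line and
the one leaving it do not cross, so one of the two, truncated, replaces their
concatenation. Deleting all lines yields a contradiction.

Adding one neighbour of each left end gives a total forcing set of at most
[2 * k] vertices. In the disjoint union of [k] edges the only total forcing set
is the whole vertex set, and the upper bound itself shows that this graph is not
a graph of [j]-parallel paths for [j < k].
*)

Set Implicit Arguments.
Unset Strict Implicit.
Unset Printing Implicit Defensive.

Import Order.TTheory GRing.Theory Num.Theory.

(** * Stationary sets of the forcing process *)

Section Forcing.
Variable G : sgraph.
Implicit Types A F : {set G}.

(** Each non-stationary step colours a new vertex, so the process ends in a stationary superset of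
    [F]; only such sets need study. *)
Lemma forcing_stable F :
  (forall A, F \subset A -> force_step A = A -> A = [set: G]) -> forcing F.
Proof.
move=> stabT; apply/forcingP.
have [n] := ubnP #|~: F|; elim: n F stabT => // n IHn F stabT leF.
case: (eqVneq (force_step F) F) => [fixF|nfixF].
  by exists 0; apply: stabT.
have prF : F \proper force_step F by rewrite properEneq eq_sym nfixF subsetUl.
have [||m defT] := IHn (force_step F).
- by move=> A sFA; apply: stabT; apply: subset_trans sFA; apply: subsetUl.
- rewrite -ltnS; apply: leq_trans leF; rewrite ltnS.
  by apply: proper_card; rewrite properE !setCS -properE.
by exists m.+1; rewrite iterSr.
Qed.

Lemma stable_other_nbr A u v :
  force_step A = A -> u \in A -> v \notin A -> edge u v ->
  exists w, [/\ edge u w, w \notin A & w != v].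
Proof.
move=> fixA Au nAv euv.
have : nbrs u :\: A != [set v].
  apply: contra nAv => /eqP defv; rewrite -fixA inE; apply/orP; right.
  by rewrite inE; apply/existsP; exists u; rewrite Au defv eqxx.
have sub : [set v] \subset nbrs u :\: A by rewrite sub1set !inE nAv.
rewrite eq_sym eqEsubset sub /= => /subsetPn[w].
by rewrite !inE => /andP[nAw euw] nwv; exists w.
Qed.

Lemma total_forcing_number_le A : no_isolated_vertex G ->
  total_forcing A -> total_forcing_number G <= #|A|.
Proof.
move=> noiso tfA; rewrite /total_forcing_number.
case: arg_minnP => [|B _]; last exact.
apply/andP; split; first by apply/forcingP; exists 0.
apply/forall_inP => u _; apply/exists_inP.
by have [v euv] := noiso u; exists v; rewrite ?inE.
Qed.

End Forcing.

(** * Non-crossing segments between horizontal lines *)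

Local Open Scope ring_scope.

(* [x s y] is the abscissa of the segment [s] at height [y], and [dom s] the
   interval of heights that it spans. *)
Lemma noncrossing_acyclic (R : realFieldType) (I : finType) (S : Type)
    (h f : I -> R) (x : S -> R -> R) (dom : S -> R -> Prop) (A : {set I}) :
  (forall s y1 y2 y, dom s y1 -> dom s y2 -> y1 <= y <= y2 -> dom s y) ->
  (forall s s' y y', dom s y -> dom s y' -> dom s' y -> dom s' y' ->
     x s y < x s' y -> x s y' <= x s' y') ->
  (forall i, i \in A -> exists j, exists s,
     [/\ j \in A, dom s (h i), dom s (h j), x s (h i) <= f i
       & f j < x s (h j)]) ->
  A = set0.
Proof.
move=> dom_cvx noncross.
have [n] := ubnP #|A|; elim: n A => [A|n IHn A leA next]; first by rewrite ltn0.
have [//|[i0 Ai0]] := set_0Vmem A; exfalso.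
(* [T] is a highest line of [A], and [s] leaves it towards [j]. *)
case: (@arg_maxP _ _ _ i0 [pred i | i \in A] h Ai0) => T /= AT maxT.
have [j [s [Aj sT sj leT ltj]]] := next T AT.
have njT : j != T by apply/eqP => eqjT; move: ltj; rewrite eqjT ltNge leT.
suff defA : A :\ T = set0.
  by have := in_set0 j; rewrite -defA !inE njT Aj.
apply: IHn => [|i]; first by move: leA; rewrite (cardsD1 T) AT.
rewrite !inE => /andP[niT Ai].
have [l [s' [Al s'i s'l lei ltl]]] := next i Ai.
have [eqlT|nlT] := eqVneq l T; last by exists l, s'; rewrite !inE nlT Al.
subst l.
have hiT := maxT i Ai; have hjT := maxT j Aj.
(* At [T], [s] is left of [s'], and it stays weakly left at the higher of [h i] and [h j]. If that
   is [h j], [s'] cut there is still right of [f j]; otherwise [s] cut at [h i] is at or left of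
   [f i]. *)
have lt_ss' : x s (h T) < x s' (h T) by apply: le_lt_trans ltl.
case: (leP (h i) (h j)) => [hij|/ltW hji].
  have s'j : dom s' (h j) by apply: (dom_cvx s' _ _ _ s'i s'l); rewrite hij.
  exists j, s'; rewrite !inE njT Aj; split=> //.
  exact: lt_le_trans ltj (noncross _ _ _ _ sT sj s'l s'j lt_ss').
have si : dom s (h i) by apply: (dom_cvx s _ _ _ sj sT); rewrite hji.
exists j, s; rewrite !inE njT Aj; split=> //.
exact: le_trans (noncross _ _ _ _ sT si s'l s'i lt_ss') lei.
Qed.

(** * Segments as affine functions of the height *)

Section Segments.
Variable R : realType.
Implicit Types a b : R * R.

(* Division by [0] gives the junk value [a.1] if [a.2 = b.2]. *)
Definition abscissa a b (y : R) : R :=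
  a.1 + (y - a.2) / (b.2 - a.2) * (b.1 - a.1).

Lemma abscissa_left a b : abscissa a b a.2 = a.1.
Proof. by rewrite /abscissa subrr !mul0r addr0. Qed.

Lemma abscissa_right a b : a.2 != b.2 -> abscissa a b b.2 = b.1.
Proof.
by move=> nab; rewrite /abscissa divff ?subr_eq0 1?eq_sym // mul1r addrC subrK.
Qed.

Lemma abscissa_in_open_segment a b y :
  a.2 < y < b.2 -> in_open_segment a b (abscissa a b y, y).
Proof.
move=> /andP[ay yb]; have ab : 0 < b.2 - a.2 by rewrite subr_gt0 (lt_trans ay).
exists ((y - a.2) / (b.2 - a.2)).
  by rewrite divr_gt0 ?(ltr_pdivrMr, ab, subr_gt0 a.2 y) // mul1r ltrD2r.
have n0 := lt0r_neq0 ab.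
by congr pair; rewrite /abscissa; field.
Qed.

(** The difference [d] of the abscissas is affine in the height and changes sign from [y] to [y'],
    hence vanishes strictly between. *)
Lemma abscissa_crossing a b a' b' (y y' : R) :
  abscissa a b y < abscissa a' b' y -> abscissa a' b' y' < abscissa a b y' ->
  exists2 z, (y < z < y') || (y' < z < y) & abscissa a b z = abscissa a' b' z.
Proof.
rewrite /abscissa; set c := (b.2 - a.2)^-1; set c' := (b'.2 - a'.2)^-1.
move=> lty gty.
pose m := c * (b.1 - a.1) - c' * (b'.1 - a'.1).
pose d (z : R) := a.1 - a'.1 - a.2 * c * (b.1 - a.1) + a'.2 * c' * (b'.1 - a'.1)
  + z * m.
have dE z : a.1 + (z - a.2) * c * (b.1 - a.1)
    - (a'.1 + (z - a'.2) * c' * (b'.1 - a'.1)) = d z by rewrite /d /m; ring.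
have dy : d y < 0 by rewrite -dE subr_lt0.
have dy' : 0 < d y' by rewrite -dE subr_gt0.
have dlin : d y' - d y = (y' - y) * m by rewrite /d; ring.
have D0 : 0 < d y' - d y by lra.
(* The root of the affine function [t |-> d y + t * (d y' - d y)]. *)
pose t := - d y / (d y' - d y).
have t0 : 0 < t by rewrite divr_gt0 //; lra.
have t1 : t < 1 by rewrite ltr_pdivrMr //; lra.
exists (y + t * (y' - y)).
  have [lyy'|lyy'|eyy'] := ltgtP y y'.
  - by apply/orP; left; apply/andP; split; nra.
  - by apply/orP; right; apply/andP; split; nra.
  - by move: D0; rewrite dlin eyy' subrr mul0r ltxx.
apply/eqP; rewrite -subr_eq0 dE; apply/eqP.
have -> : d (y + t * (y' - y)) = d y + t * (d y' - d y) by rewrite dlin /d; ring.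
by rewrite /t divfK ?lt0r_neq0 // subrr.
Qed.

End Segments.

(** * The upper bound *)

Section UpperBound.
Variables (R : realType) (G : sgraph) (k : nat) (P : 'I_k -> seq G).
Variables (h : 'I_k -> R) (pos : G -> R * R).
Hypothesis indP : forall i, induced_path (P i).
Hypothesis coverP : forall v, exists! i, v \in P i.
Hypothesis drawP : parallel_drawing P h pos.

(** Edges are oriented upwards: a pair whose first end is the higher one spans no height. *)
Let dom (e : G * G) (y : R) : Prop :=
  cross_edge P e.1 e.2 /\ (pos e.1).2 <= y <= (pos e.2).2.

Let x (e : G * G) : R -> R := abscissa (pos e.1) (pos e.2).

(** A change of order would give, by [abscissa_crossing], a point interior to both segments. *)
Lemma edges_noncrossing e e' y y' : dom e y -> dom e y' -> dom e' y ->
  dom e' y' -> x e y < x e' y -> x e y' <= x e' y'.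
Proof.
case: drawP => _ _ _ _ noX.
case: e e' => [u v] [u' v'] [/= ce /andP[u1 v1]] [/= _ /andP[u2 v2]].
case=> /= ce' /andP[u1' v1'] [/= _ /andP[u2' v2']] lty.
rewrite leNgt; apply/negP => gty.
have [z btw eqz] := abscissa_crossing lty gty.
have uzv : (pos u).2 < z < (pos v).2.
  by case/orP: btw => /andP[? ?]; apply/andP; split; lra.
have uzv' : (pos u').2 < z < (pos v').2.
  by case/orP: btw => /andP[? ?]; apply/andP; split; lra.
apply: (noX _ _ _ _ ce ce' _ (abscissa (pos u) (pos v) z, z)); last first.
  by split; [|rewrite eqz]; apply: abscissa_in_open_segment.
(* The edges are distinct: the same ends in the same order give equal abscissas, and in reverse
   order both cannot point upwards. *)
move=> eq_ee'; move: lty; rewrite /x /=.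
have: u \in [set u'; v'] by rewrite -eq_ee' set21.
have: v \in [set u'; v'] by rewrite -eq_ee' set22.
move: uzv uzv' => /andP[uz zv] /andP[uz' zv'].
rewrite !inE => /orP[]/eqP eqv /orP[]/eqP equ; subst u v; rewrite ?ltxx //.
all: by move: uz zv uz' zv'; lra.
Qed.

Lemma stable_set_full (A : {set G}) :
  (forall i v, ohead (P i) = Some v -> v \in A) -> force_step A = A ->
  A = [set: G].
Proof.
move=> headA fixA; case: drawP => h_inj hP posP _ _.
apply/eqP; rewrite -subTset; apply/subsetP => x0 _; apply: contraT => nAx0.
(* [m i] is the first non-coloured position on [P i], or its length if there is none; on a bad path
   it is positive, as the head is coloured. *)
pose m i := find (predC (mem A)) (P i).
pose bad := [set i | has (predC (mem A)) (P i)].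
pose fr i := nth x0 (P i) (m i).-1.
have badP i w : w \in P i -> w \notin A -> i \in bad.
  by move=> Pw nAw; rewrite inE; apply/hasP; exists w.
have prefA i l : (l < m i)%N -> nth x0 (P i) l \in A.
  by move=> lm; have := before_find x0 lm => /negbFE.
have m_gt0 i : i \in bad -> (0 < m i)%N.
  rewrite inE /m; case defPi: (P i) => [//|v s] _ /=.
  by rewrite (headA i v) ?defPi.
suff bad0 : bad = set0.
  have [i [Px0 _]] := coverP x0.
  by have := badP i x0 Px0 nAx0; rewrite bad0 inE.
apply: (@noncrossing_acyclic _ _ _ h (fun i => (pos (fr i)).1) x dom).
- move=> e y1 y2 y [ce /andP[l1 _]] [_ /andP[_ r2]] /andP[ly yr].
  by split=> //; rewrite (le_trans l1) // (le_trans yr).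
- exact: edges_noncrossing.
move=> i bad_i; have m0 := m_gt0 i bad_i.
have [_ uniqP edgeP] := indP i.
have ltm : (m i < size (P i))%N by rewrite -has_find; rewrite inE in bad_i.
have ltm1 : ((m i).-1 < size (P i))%N by rewrite (leq_ltn_trans (leq_pred _)).
have Pfr : fr i \in P i by apply: mem_nth.
have idx_fr : index (fr i) (P i) = (m i).-1 by apply: index_uniq.
have Afr : fr i \in A by apply: prefA; rewrite prednK.
have nAs : nth x0 (P i) (m i) \notin A.
  by rewrite inE in bad_i; exact: (nth_find x0 bad_i).
have efs : edge (fr i) (nth x0 (P i) (m i)).
  by rewrite edgeP ?mem_nth // idx_fr index_uniq // prednK ?eqxx.
have [w [efw nAw nws]] := stable_other_nbr fixA Afr nAs efs.
have [j [Pw uniqj]] := coverP w.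
have idx_w : (m j <= index w (P j))%N.
  rewrite leqNgt; apply/negP => /prefA.
  by rewrite nth_index // (negbTE nAw).
have bad_j := badP j w Pw nAw.
(* On the induced path [P i], [fr i] is adjacent only to its successor, which differs from [w], and
   to its predecessor, which is coloured. *)
have nij : i != j.
  apply/eqP => eqij; subst j; move: efw; rewrite edgeP // idx_fr prednK //.
  case/orP => /eqP eq_idx.
    by case/eqP: nws; rewrite -eq_idx nth_index.
  by move: idx_w; rewrite leqNgt -[X in (_ < X)%N](prednK m0) eq_idx ltnS leqnSn.
have lt_frw : (pos (fr j)).1 < (pos w).1.
  have tr : transitive (fun u v : G => (pos u).1 < (pos v).1).
    by move=> a b c; apply: lt_trans.
  rewrite -(nth_index x0 Pw); apply: (sorted_ltn_nth tr x0 (posP j)).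
  - rewrite inE (leq_ltn_trans (leq_pred _)) // -has_find.
    by rewrite inE in bad_j.
  - by rewrite inE index_mem.
  - by rewrite (leq_trans _ idx_w) // prednK ?m_gt0.
have cfw : cross_edge P (fr i) w.
  split=> // l [Pl_fr Pl_w]; case/eqP: nij.
  have [l' [_ uniql]] := coverP (fr i).
  by rewrite -(uniql i Pfr) (uniql l Pl_fr) (uniqj l Pl_w).
have cwf : cross_edge P w (fr i).
  by case: cfw => _ nfw; split=> [|l [? ?]]; [rewrite edge_sym | case: (nfw l)].
have hfr := hP i _ Pfr; have hw := hP j _ Pw.
(* The lower end comes first, as [dom] requires. *)
exists j; have [lt_h|gt_h|eq_h] := ltgtP (h i) (h j); last first.
- by case/eqP: nij; apply: h_inj.
- exists (w, fr i); rewrite /dom /x /= hfr hw !lexx (ltW gt_h); split=> //.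
  + by rewrite -hfr abscissa_right // hfr hw lt_eqF.
  + by rewrite -hw abscissa_left.
- exists (fr i, w); rewrite /dom /x /= hfr hw !lexx (ltW lt_h); split=> //.
  + by rewrite -hfr abscissa_left.
  + by rewrite -hw abscissa_right // hfr hw lt_eqF.
Qed.

End UpperBound.

Lemma has_parallel_drawing_le (R : realType) (G : sgraph) k :
  has_parallel_drawing R G k -> no_isolated_vertex G ->
  (total_forcing_number G <= 2 * k)%N.
Proof.
case=> P [indP coverP [h [pos drawP]]] noiso.
have headP i : {v | ohead (P i) = Some v}.
  case defPi: (P i) => [|v s]; last by exists v.
  by exfalso; case: (indP i); rewrite defPi.
have nbrP (u : G) : {v | edge u v}.
  by apply: sigW; have [v euv] := noiso u; exists v.
pose F := [set sval (headP i) | i : 'I_k].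
(* Each vertex of [F] is adjacent to its chosen neighbour in [F'], so none is isolated in the
   union. *)
pose F' := [set sval (nbrP u) | u in F].
have leF : (#|F| <= k)%N by rewrite (leq_trans (leq_imset_card _ _)) ?card_ord.
have tfF : total_forcing (F :|: F').
  apply/andP; split.
    apply: forcing_stable => A sFA; apply: (stable_set_full indP coverP drawP).
    move=> i v headv; apply: (subsetP sFA); rewrite inE; apply/orP; left.
    by apply/imsetP; exists i => //; case: (headP i) => w /=; rewrite headv => [[]].
  apply/forall_inP => u; rewrite inE => /orP[Fu|/imsetP[v Fv ->]].
    apply/exists_inP; exists (sval (nbrP u)); last by case: (nbrP u).
    by rewrite inE; apply/orP; right; apply/imsetP; exists u.
  apply/exists_inP; exists v; first by rewrite inE Fv.
  by rewrite edge_sym; case: (nbrP v).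
apply: leq_trans (total_forcing_number_le noiso tfF) _.
rewrite (leq_trans (leq_card_setU _ _)) // mul2n -addnn leq_add //.
exact: leq_trans (leq_imset_card _ _) leF.
Qed.

(** Brings the case of one path, defined without a drawing, under the general bound. *)
Lemma path_graph_drawing (R : realType) (G : sgraph) :
  is_path_graph G -> has_parallel_drawing R G 1.
Proof.
case=> s inds coverS; exists (fun=> s); split=> //.
  by move=> v; exists ord0; split=> [|i _]; [apply: coverS | rewrite [i]ord1].
have no_cross u v : ~ cross_edge (fun _ : 'I_1 => s) u v.
  by case=> _ /(_ ord0); apply.
exists (fun=> 0), (fun v => ((index v s)%:R, 0)); split=> //.
- by move=> i j _; rewrite [i]ord1 [j]ord1.
- move=> _ /=; have [_ uniq_s _] := inds.
  case defs: s => [//|v0 s']; rewrite -defs.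
  apply/(sortedP v0) => l ltl.
  by rewrite ltr_nat !index_uniq // ltnW.
- by move=> u v w /no_cross.
- by move=> u v u' v' /no_cross.
Qed.

Lemma parallel_paths_le (R : realType) (G : sgraph) k :
  parallel_paths R G k -> no_isolated_vertex G ->
  (total_forcing_number G <= 2 * k)%N.
Proof.
case: k => [//|[|k]] parG; apply: (@has_parallel_drawing_le R).
  exact: path_graph_drawing.
by case/parallel_pathsSS: parG.
Qed.

(** * Sharpness: disjoint edges *)

Section DisjointEdges.
Variable k : nat.

Definition matching_rel : rel ('I_k * bool) :=
  [rel u v | (u.1 == v.1) && (u.2 != v.2)].

Lemma matching_sym : symmetric matching_rel.
Proof. by move=> u v; rewrite /matching_rel /= eq_sym (eq_sym u.2). Qed.

Lemma matching_irrefl : irreflexive matching_rel.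
Proof. by move=> u; rewrite /matching_rel /= !eqxx. Qed.

Definition matching_graph := SGraph matching_sym matching_irrefl.

Lemma matching_no_isolated : no_isolated_vertex matching_graph.
Proof. by case=> i b; exists (i, ~~ b); rewrite /= /matching_rel /= eqxx; case: b. Qed.

(** Totality puts the partner of each vertex of [A] into [A], so no vertex of [A] has a neighbour
    left to force. *)
Lemma matching_total_forcing (A : {set matching_graph}) :
  total_forcing A -> A = [set: matching_graph].
Proof.
case/andP => /forcingP[n defT] /forall_inP totA.
have partner i b : ((i, b) \in A) -> (i, ~~ b) \in A.
  move=> Aib; have /exists_inP[[j c] Ajc] := totA _ Aib.
  by case/andP=> /= /eqP-> /eqP; case: b c Ajc {Aib} => [] [].
suff inA m i b : (i, b) \in iter m (@force_step matching_graph) A -> (i, b) \in A.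
  by apply/setP => -[i b]; rewrite inE (inA n) // defT inE.
elim: m i b => [//|m IHm] i b; rewrite iterS inE => /orP[/IHm //|].
rewrite inE => /exists_inP[[j c] /IHm Ajc /eqP def_ib].
have : (i, b) \in nbrs ((j, c) : matching_graph) by
  have := set11 ((i, b) : matching_graph); rewrite -def_ib inE => /andP[].
rewrite inE => /andP[/= /eqP eqji neqcb]; subst j.
by have := partner i c Ajc; case: b c neqcb {Ajc def_ib} => [] [].
Qed.

Lemma matching_total_forcing_number :
  total_forcing_number matching_graph = (2 * k)%N.
Proof.
rewrite /total_forcing_number; case: arg_minnP => [|A /matching_total_forcing-> _].
  apply/andP; split; first by apply/forcingP; exists 0.
  apply/forall_inP => u _; apply/exists_inP.
  by have [v euv] := matching_no_isolated u; exists v; rewrite ?inE.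
by rewrite cardsT card_prod card_ord card_bool mulnC.
Qed.

Lemma matching_drawing (R : realType) : has_parallel_drawing R matching_graph k.
Proof.
pose P (i : 'I_k) : seq matching_graph := [:: (i, false); (i, true)].
have memP i j b : ((j, b) : matching_graph) \in P i = (j == i).
  by rewrite !inE -!pair_eqE /=; case: b; rewrite ?andbT ?andbF ?orbF.
have no_cross u v : ~ cross_edge P u v.
  by case: u v => i b [j c] [/andP[/= /eqP <- _] /(_ i)]; rewrite !memP eqxx; apply.
exists P; split=> [i|[i b]|].
- have ne b : ((i, b) == (i, ~~ b) :> matching_graph) = false.
    by rewrite -pair_eqE /= andbC; case: b.
  split=> //=; first by rewrite inE (ne false).
  move=> [j b] [l c]; rewrite !memP => /eqP-> /eqP->.
  by rewrite /= /matching_rel /=; case: b c => [] [];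
    rewrite ?eqxx ?(ne true) ?(ne false).
- by exists i; split=> [|j]; rewrite memP // => /eqP.
exists (fun i => (i : nat)%:R).
exists (fun v : matching_graph => ((v.2 : nat)%:R, (v.1 : nat)%:R)).
split.
- by move=> i j /eqP; rewrite eqr_nat => /eqP/val_inj.
- by move=> i [j b]; rewrite memP => /eqP->.
- by move=> i /=; rewrite ltr_nat.
- by move=> u v w /no_cross.
- by move=> u v u' v' /no_cross.
Qed.

End DisjointEdges.

Lemma matching_parallel_paths (R : realType) k :
  (0 < k)%N -> parallel_paths R (matching_graph k) k.
Proof.
case: k => [//|[|k]] _.
  have [P [indP coverP _]] := matching_drawing 1 R.
  exists (P ord0) => // v; have [i [Pv _]] := coverP v.
  by rewrite ord1 in Pv.
apply/parallel_pathsSS; split; last exact: matching_drawing.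
(* With [j] paths the upper bound would give [2 * k.+2 <= 2 * j]. *)
move=> j /andP[_ ltjk] /parallel_paths_le /(_ (@matching_no_isolated _)).
by rewrite matching_total_forcing_number leq_mul2l leqNgt ltjk.
Qed.

Local Close Scope ring_scope.

Theorem corollary5 (R : realType) (k : nat) (hk : 1 <= k) :
  (forall G : sgraph, parallel_paths R G k -> no_isolated_vertex G ->
     total_forcing_number G <= 2 * k)
  /\ (exists G : sgraph, [/\ parallel_paths R G k, no_isolated_vertex G
       & total_forcing_number G = 2 * k]).
Proof.
split=> [G|]; first exact: parallel_paths_le.
exists (matching_graph k); split.
- exact: matching_parallel_paths.
- exact: matching_no_isolated.
- exact: matching_total_forcing_number.
Qed.
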